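(* Let $M$ be a closed orientable surface of genus $g\ge1$, and let $u:\mathbb{Z}[B_n(M)]\to\widehat{\mathcal{A}}_n\rtimes\mathbb{Z}[H_n]$ be a filtration-preserving homomorphism of $\mathbb{Z}$-modules whose associated graded map $\mathrm{gr}\,u:\mathrm{gr}_V\mathbb{Z}[B_n(M)]\to\mathcal{A}_n\rtimes\mathbb{Z}[H_n]$ is an isomorphism of graded $\mathbb{Z}$-algebras. Then every Vassiliev invariant of $B_n(M)$ factors through $u$ in a unique way.
   Context: Braids and Vassiliev filtration. $M$ is a closed orientable surface of genus $g\ge 1$, and $\mathcal{P}=\{P_1,\dots,P_n\}\subset M$ is a set of $n$ distinct points. An $n$-braid is a collection $b=(b_1,\dots,b_n)$ of disjoint smooth paths (strings) in $M\times[0,1]$, $b_i$ running monotonically in $t\in[0,1]$ from $(P_i,0)$ to some $(P_j,1)$; isotopy classes (fixing ends) under concatenation form the group $B_n(M)$. Singular braids may in addition have finitely many transverse double points (singular points); their isotopy classes form a monoid $SB_n(M)$, and $S_dB_n(M)$ is the set of those with exactly $d$ singular points. The multiplicative map $\eta:SB_n(M)\to\mathbb{Z}[B_n(M)]$ is the identity on braids and is obtained by resolving all singular points by the rule $\eta(b)=\eta(b_+)-\eta(b_-)$, where $b_\pm$ are obtained from $b$ by replacing a singular point by a positive, resp. negative, crossing (well defined as $M$ is orientable). $V_d$ is the $\mathbb{Z}$-submodule (a two-sided ideal) of $\mathbb{Z}[B_n(M)]$ generated by $\eta(S_dB_n(M))$; one has $V_0=\mathbb{Z}[B_n(M)]$,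 $V_{d+1}\subset V_d$, and $\mathrm{gr}_V\mathbb{Z}[B_n(M)]=\bigoplus_{d\ge0}V_d/V_{d+1}$. An invariant with values in an abelian group $A$ is a set map $v:B_n(M)\to A$, extended linearly to $\mathbb{Z}[B_n(M)]$; it is a Vassiliev invariant of type $d$ if it vanishes on $V_{d+1}$ (equivalently, its extension $v(\eta(b))$ vanishes for every singular braid $b$ with more than $d$ singular points). The algebra $\mathcal{A}_n$. It is the associative $\mathbb{Z}$-algebra generated by symbols $t_{i,j,\gamma}$, $i,j\in\{1,\dots,n\}$, $i\ne j$, $\gamma\in\pi_1(M)$, with $t_{i,j,\gamma}=t_{j,i,\gamma^{-1}}$, subject to the relations $[t_{i,j,\gamma},t_{k,l,\delta}]=0$ for all distinct $i,j,k,l$, and $[t_{i,j,\gamma},\,t_{j,k,\delta}+t_{i,k,\gamma\delta}]=0$ for all distinct $i,j,k$, for all $\gamma,\delta\in\pi_1(M)$, where $[x,y]=xy-yx$. It is graded with each $t_{i,j,\gamma}$ of degree $1$; $\widehat{\mathcal{A}}_n$ is its completion with respect to the degree, and $\widehat{\mathcal{A}}_n^{(\ge d)}$ is the ideal of series whose terms all have degree $\ge d$. The semidirect products. $H_n=\pi_1(M)^n\rtimes\Sigma_n$, where the symmetric group $\Sigma_n$ permutes coordinates; for $\mu\in\pi_1(M)$, $\mu(k)\in\pi_1(M)^n$ has $\mu$ in position $k$ and $1$ elsewhere. $H_n$ acts on $\mathcal{A}_n$ and $\widehat{\mathcal{A}}_n$ by algebra automorphisms determined by $\sigma t_{i,j,\gamma}\sigma^{-1}=t_{\sigma(i),\sigma(j),\gamma}$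 for $\sigma\in\Sigma_n$; $\mu(k)t_{i,j,\gamma}\mu(k)^{-1}=t_{i,j,\gamma}$ for $k\ne i,j$; $\mu(i)t_{i,j,\gamma}\mu(i)^{-1}=t_{i,j,\mu\gamma}$. $\widehat{\mathcal{A}}_n\rtimes\mathbb{Z}[H_n]$ is $\widehat{\mathcal{A}}_n\otimes\mathbb{Z}[H_n]$ with product $(a\otimes h)(a'\otimes h')=a(ha'h^{-1})\otimes hh'$ for $h,h'\in H_n$, filtered by $\widehat{\mathcal{A}}_n^{(\ge d)}\otimes\mathbb{Z}[H_n]$, with associated graded algebra $\mathcal{A}_n\rtimes\mathbb{Z}[H_n]$. The map $u$ is filtration-preserving if $u(V_d)\subset\widehat{\mathcal{A}}_n^{(\ge d)}\otimes\mathbb{Z}[H_n]$ for all $d$; $\mathrm{gr}\,u$ is the induced map. Such a map $u$ exists.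
   Formalization: Uniqueness of the factorization is claimed only among Z-linear maps vanishing on some filtration step (continuous for the degree filtration); among all Z-linear maps out of the completion it fails, since the image of u is only dense. *)

(* Defs.v *)
From HB Require Import structures.
From mathcomp Require Import all_boot all_order all_algebra all_fingroup.
From mathcomp Require Import generic_quotient finmap.
From mathcomp Require Import all_classical reals topology normedtype derive.
From mathcomp Require Import lra.
From Stdlib Require Import Relations.
(* The notations of monalg clash with those of MathComp-Analysis. *)
From mathcomp.multinomials Require Import -(notations) monalg.

Set Implicit Arguments.
Unset Strict Implicit.
Unset Printing Implicit Defensive.

Import Order.TTheory GRing.Theory Num.Theory.
Import numFieldNormedType.Exports.

Local Open Scope classical_set_scope.
Local Open Scope ring_scope.
Local Open Scope quotient_scope.

Section FundamentalGroup.
Context {R : realType} {T : topologicalType}.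

Lemma paste_continuous (X : topologicalType) (p : X -> R) (c : R)
    (f1 f2 : X -> T) :
  continuous p -> continuous f1 -> continuous f2 ->
  (forall x, p x = c -> f1 x = f2 x) ->
  continuous (fun x => if p x <= c then f1 x else f2 x).
Proof.
move=> cp c1 c2 e; set F := (X in continuous X).
have cA : closed [set x | p x <= c].
  by apply: (@closed_comp _ _ p [set y | y <= c]) => [x _|]; [exact: cp|exact: closed_le].
have cB : closed [set x | c <= p x].
  by apply: (@closed_comp _ _ p [set y | c <= y]) => [x _|]; [exact: cp|exact: closed_ge].
have AB : [set x | p x <= c] `|` [set x | c <= p x] = setT.
  by apply/seteqP; split=> // x _ /=; apply/orP; exact: le_total.
apply/continuous_subspace_setT; rewrite -AB; apply: withinU_continuous => //.
  apply: (@subspace_eq_continuous _ _ _ f1); last exact: continuous_subspaceT.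
  by move=> x /set_mem /= px; rewrite /from_subspace /F /= ifT.
apply: (@subspace_eq_continuous _ _ _ f2); last exact: continuous_subspaceT.
move=> x /set_mem /= cx; rewrite /from_subspace /F /=; case: ifPn => // xc.
by rewrite -e//; apply/eqP; rewrite eq_le xc cx.
Qed.

Lemma continuous_comp2 (X : topologicalType) (H : R * R -> T) (a b : X -> R) :
  continuous H -> continuous a -> continuous b ->
  continuous (fun x => H (a x, b x)).
Proof.
move=> cH ca cb x; apply: (@continuous_comp _ _ _ (fun x => (a x, b x))).
  exact: (cvg_pair (ca x) (cb x)).
exact: cH.
Qed.

Local Ltac cts := move=> ?; do ?[exact: cvg_cst | exact: cvg_id | exact: cvg_fst
  | exact: cvg_snd | apply: cvgB | apply: cvgM].

(* A path on [0, 1] is extended to R by its end values. *)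
Record loop (x0 : T) := Loop {
  loop_fun :> R -> T;
  loop_continuous : continuous loop_fun;
  loop_le0 : forall t, t <= 0 -> loop_fun t = x0;
  loop_ge1 : forall t, 1 <= t -> loop_fun t = x0 }.

HB.instance Definition _ x0 := gen_eqMixin (loop x0).
HB.instance Definition _ x0 := gen_choiceMixin (loop x0).

Context {x0 : T}.
Implicit Types f g h : loop x0.

Lemma loop_eqP f g : f =1 g -> f = g.
Proof.
case: f g => [f c a b] [g c' a' b'] /= /funext fg; subst g.
by congr Loop; exact: Prop_irrelevance.
Qed.

Definition loop_homotopic f g := exists H : R * R -> T,
  [/\ continuous H,
      forall t, H (0, t) = f t,
      forall t, H (1, t) = g t &
      forall s t, t <= 0 \/ 1 <= t -> H (s, t) = x0].

Lemma loop_homotopic_refl f : loop_homotopic f f.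
Proof.
exists (fun p => f p.2); split=> //.
  by move=> p; apply: continuous_comp; [exact: cvg_snd|exact: loop_continuous].
by move=> s t [/loop_le0|/loop_ge1] /= ->.
Qed.

Lemma loop_homotopic_sym f g : loop_homotopic f g -> loop_homotopic g f.
Proof.
move=> [H [cH H0 H1 Hx]]; exists (fun p => H (1 - p.1, p.2)); split.
- apply: (@continuous_comp2 _ H (fun p : R * R => 1 - p.1) (fun p : R * R => p.2)); [exact: cH|cts|cts].
- by move=> t /=; rewrite subr0.
- by move=> t /=; rewrite subrr.
- by move=> s t /Hx.
Qed.

Lemma loop_homotopic_trans f g h :
  loop_homotopic f g -> loop_homotopic g h -> loop_homotopic f h.
Proof.
move=> [H [cH H0 H1 Hx]] [K [cK K0 K1 Kx]].
exists (fun p => if p.1 <= 2^-1 then H (2 * p.1, p.2) else K (2 * p.1 - 1, p.2)).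
split.
- apply: paste_continuous.
  + by move=> p; exact: cvg_fst.
  + apply: (@continuous_comp2 _ H (fun p : R * R => 2 * p.1) (fun p : R * R => p.2)); [exact: cH|cts|cts].
  + apply: (@continuous_comp2 _ K (fun p : R * R => 2 * p.1 - 1) (fun p : R * R => p.2)); [exact: cK|cts|cts].
  + by move=> p /= ->; rewrite mulfV ?pnatr_eq0// subrr H1 K0.
- by move=> t /=; rewrite ifT ?mulr0//; lra.
- move=> t /=; rewrite ifF; last by apply/negbTE; rewrite -ltNge; lra.
  by rewrite -K1; congr (K (_, _)); lra.
- by move=> s t tx /=; case: ifP => _; rewrite (Hx, Kx).
Qed.

Definition loop_cst : loop x0.
Proof. by exists (fun=> x0) => // x; exact: cvg_cst. Defined.

Definition loop_inv f : loop x0.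
Proof.
exists (fun t => f (1 - t)).
- move=> t; apply: (@continuous_comp _ _ _ (fun t : R => 1 - t)).
    by apply: cvgB; [exact: cvg_cst|exact: cvg_id].
  exact: loop_continuous.
- by move=> t t0; apply: loop_ge1; lra.
- by move=> t t1; apply: loop_le0; lra.
Defined.

Definition loop_concat f g : loop x0.
Proof.
exists (fun t => if t <= 2^-1 then f (2 * t) else g (2 * t - 1)).
- apply: (@paste_continuous _ id).
  + by move=> t; exact: cvg_id.
  + move=> t; apply: (@continuous_comp _ _ _ (fun t : R => 2 * t)).
      by apply: cvgM; [exact: cvg_cst|exact: cvg_id].
    exact: loop_continuous.
  + move=> t; apply: (@continuous_comp _ _ _ (fun t : R => 2 * t - 1)).
      apply: cvgB; last exact: cvg_cst.
      by apply: cvgM; [exact: cvg_cst|exact: cvg_id].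
    exact: loop_continuous.
  + by move=> t /= ->; rewrite loop_ge1 ?loop_le0//; lra.
- by move=> t t0; case: ifP => _; rewrite loop_le0//; lra.
- by move=> t t0; case: ifPn => tx; rewrite loop_ge1//; lra.
Defined.

Lemma loop_inv_homotopic f g :
  loop_homotopic f g -> loop_homotopic (loop_inv f) (loop_inv g).
Proof.
move=> [H [cH H0 H1 Hx]]; exists (fun p => H (p.1, 1 - p.2)); split.
- apply: (@continuous_comp2 _ H (fun p : R * R => p.1) (fun p : R * R => 1 - p.2)); [exact: cH|cts|cts].
- by move=> t /=; rewrite H0.
- by move=> t /=; rewrite H1.
- by move=> s t tx /=; rewrite Hx//; case: tx => ?; [right|left]; lra.
Qed.

Lemma loop_concat_homotopic f f' g g' :
  loop_homotopic f f' -> loop_homotopic g g' ->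
  loop_homotopic (loop_concat f g) (loop_concat f' g').
Proof.
move=> [H [cH H0 H1 Hx]] [K [cK K0 K1 Kx]].
exists (fun p => if p.2 <= 2^-1 then H (p.1, 2 * p.2) else K (p.1, 2 * p.2 - 1)).
split.
- apply: paste_continuous.
  + by move=> p; exact: cvg_snd.
  + apply: (@continuous_comp2 _ H (fun p : R * R => p.1) (fun p : R * R => 2 * p.2)); [exact: cH|cts|cts].
  + apply: (@continuous_comp2 _ K (fun p : R * R => p.1) (fun p : R * R => 2 * p.2 - 1)); [exact: cK|cts|cts].
  + by move=> p /= e; rewrite Hx ?Kx// e; [left|right]; lra.
- by move=> t /=; rewrite H0 K0.
- by move=> t /=; rewrite H1 K1.
- move=> s t tx /=; case: ifPn => t2; rewrite (Hx, Kx)//;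
    by case: tx => ?; [left|right]; lra.
Qed.

Let clamp (s : R) := Num.min 1 (Num.max 0 s).

Let clamp_continuous : continuous clamp.
Proof.
move=> s; apply: continuous_min; first exact: cvg_cst.
by apply: continuous_max; [exact: cvg_cst|exact: cvg_id].
Qed.

Let clampP s : 0 <= clamp s <= 1.
Proof. by rewrite /clamp le_min ler01 le_max lexx ge_min lexx. Qed.

Lemma loop_reparam f g (phi : R -> R) :
  continuous phi -> (forall t, t <= 0 -> phi t <= 0) ->
  (forall t, 1 <= t -> 1 <= phi t) -> (forall t, g t = f (phi t)) ->
  loop_homotopic g f.
Proof.
move=> cphi phi0 phi1 gE.
pose q (p : R * R) := (1 - clamp p.1) * phi p.2 + clamp p.1 * p.2.
have clamp0 : clamp 0 = 0 by rewrite /clamp maxxx min_r.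
have clamp1 : clamp 1 = 1 by rewrite /clamp max_r// minxx.
have c1 (p : R * R) : (fun p : R * R => clamp p.1) x @[x --> p] --> clamp p.1.
  by apply: continuous_comp; [exact: cvg_fst|exact: clamp_continuous].
exists (fun p => f (q p)); split.
- move=> p; apply: (@continuous_comp _ _ _ q); last exact: loop_continuous.
  apply: cvgD; apply: cvgM.
  + by apply: cvgB; [exact: cvg_cst|exact: c1].
  + by apply: continuous_comp; [exact: cvg_snd|exact: cphi].
  + exact: c1.
  + exact: cvg_snd.
- by move=> t; rewrite gE /q /= clamp0 subr0 mul1r mul0r addr0.
- by move=> t; rewrite /q /= clamp1 subrr mul1r mul0r add0r.
- move=> s t; rewrite /q /=; have := clampP s; move=> cs; case=> tx.
  + by rewrite loop_le0//; move: cs (phi0 t tx); nra.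
  + by rewrite loop_ge1//; move: cs (phi1 t tx); nra.
Qed.

Lemma loop_concatA f g h :
  loop_homotopic (loop_concat f (loop_concat g h))
                 (loop_concat (loop_concat f g) h).
Proof.
pose phi (t : R) := Num.max (2^-1 * t) (Num.max (t - 4^-1) (2 * t - 1)).
apply: (@loop_reparam _ _ phi).
- move=> t; apply: continuous_max; last apply: continuous_max.
  + by apply: cvgM; [exact: cvg_cst|exact: cvg_id].
  + by apply: cvgB; [exact: cvg_id|exact: cvg_cst].
  + apply: cvgB; last exact: cvg_cst.
    by apply: cvgM; [exact: cvg_cst|exact: cvg_id].
- by move=> t t0; rewrite /phi !ge_max; apply/and3P; split; lra.
- by move=> t t1; rewrite /phi !le_max; apply/or3P; apply: Or33; lra.
- move=> t; rewrite /phi /=.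
  have [t2|t2] := leP t 2^-1.
    rewrite max_l; last by rewrite ge_max; apply/andP; split; lra.
    rewrite ifT; last by lra.
    by rewrite ifT; [congr (f _); lra|lra].
  have [t4|t4] := leP (2 * t - 1) 2^-1.
    rewrite max_r; last by rewrite le_max; apply/orP; left; lra.
    rewrite max_l; last by lra.
    rewrite ifT; last by lra.
    by rewrite ifF; [congr (g _); lra|apply/negbTE; rewrite -ltNge; lra].
  rewrite max_r; last by rewrite le_max; apply/orP; right; lra.
  rewrite max_r; last by lra.
  by rewrite ifF; [congr (h _); lra|apply/negbTE; rewrite -ltNge; lra].
Qed.

Lemma loop_concat1 f : loop_homotopic (loop_concat f loop_cst) f.
Proof.
apply: (@loop_reparam _ _ (fun t => 2 * t)).
- by move=> t; apply: cvgM; [exact: cvg_cst|exact: cvg_id].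
- by move=> t; lra.
- by move=> t; lra.
- by move=> t /=; case: ifPn => // ?; rewrite loop_ge1//; lra.
Qed.

Lemma loop_1concat f : loop_homotopic (loop_concat loop_cst f) f.
Proof.
apply: (@loop_reparam _ _ (fun t => 2 * t - 1)).
- move=> t; apply: cvgB; last exact: cvg_cst.
  by apply: cvgM; [exact: cvg_cst|exact: cvg_id].
- by move=> t; lra.
- by move=> t; lra.
- by move=> t /=; case: ifPn => // ?; rewrite loop_le0//; lra.
Qed.

Lemma loop_concatV f : loop_homotopic (loop_concat f (loop_inv f)) loop_cst.
Proof.
pose q (p : R * R) := (1 - clamp p.1) * (1 - `|2 * p.2 - 1|).
have clamp0 : clamp 0 = 0 by rewrite /clamp maxxx min_r.
have clamp1 : clamp 1 = 1 by rewrite /clamp max_r// minxx.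
have cmin : continuous (fun p : R * R => (1 - `|2 * p.2 - 1|)).
  move=> p; apply: cvgB; first exact: cvg_cst.
  by apply: cvg_norm; move: p; cts.
exists (fun p => f (q p)); split.
- move=> p; apply: (@continuous_comp _ _ _ q); last exact: loop_continuous.
  apply: cvgM; last exact: cmin.
  apply: cvgB; first exact: cvg_cst.
  by apply: continuous_comp; [exact: cvg_fst|exact: clamp_continuous].
- move=> t; rewrite /q /= clamp0 subr0 mul1r; case: ifPn => t2.
    by congr (f _); rewrite ler0_norm; lra.
  by congr (f _); rewrite ger0_norm; lra.
- by move=> t; rewrite /q /= clamp1 subrr mul0r loop_le0.
- move=> s t tx; rewrite /q /= loop_le0//.
  have := clampP s; have : 1 - `|2 * t - 1| <= 0.
    by case: tx => ?; [rewrite ler0_norm|rewrite ger0_norm]; lra.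
  by nra.
Qed.

Lemma loop_invK f : loop_inv (loop_inv f) = f.
Proof. by apply: loop_eqP => t /=; congr (f _); lra. Qed.

Definition loop_homotopicb : rel (loop x0) := [rel f g | `[< loop_homotopic f g >]].

Lemma loop_homotopicb_equiv : equiv_class_of loop_homotopicb.
Proof.
split=> [f|f g|g f h] /=.
- by apply/asboolP; exact: loop_homotopic_refl.
- by apply/asboolP/asboolP; exact: loop_homotopic_sym.
- by move=> /asboolP ? /asboolP ?; apply/asboolP; exact: (@loop_homotopic_trans _ g).
Qed.

Canonical loop_equiv := EquivRelPack loop_homotopicb_equiv.

End FundamentalGroup.
Arguments loop R {T} x0.

Definition pi1 (R : realType) (T : topologicalType) (x0 : T) : Type :=
  {eq_quot (@loop_equiv R T x0)}.
Arguments pi1 R {T} x0.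

Section FundamentalGroupLaw.
Context {R : realType} {T : topologicalType} {x0 : T}.
Implicit Types a b c : pi1 R x0.

HB.instance Definition _ := Choice.on (pi1 R x0).

Definition pi1_class (f : loop R x0) : pi1 R x0 := \pi f.

Lemma pi1_classP f g : loop_homotopic f g <-> pi1_class f = pi1_class g.
Proof. by split=> [fg|/eqquotP /asboolP//]; apply/eqquotP/asboolP. Qed.

Lemma pi1_reprK a : pi1_class (repr a) = a. Proof. exact: reprK. Qed.

Definition pi1_one := pi1_class loop_cst.
Definition pi1_inv a := pi1_class (loop_inv (repr a)).
Definition pi1_mul a b := pi1_class (loop_concat (repr a) (repr b)).

Lemma pi1_invE f : pi1_inv (pi1_class f) = pi1_class (loop_inv f).
Proof. by apply/pi1_classP/loop_inv_homotopic/pi1_classP; rewrite pi1_reprK. Qed.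

Lemma pi1_mulE f g :
  pi1_mul (pi1_class f) (pi1_class g) = pi1_class (loop_concat f g).
Proof.
by apply/pi1_classP/loop_concat_homotopic; apply/pi1_classP; rewrite pi1_reprK.
Qed.

Let pi1_mulA : associative pi1_mul.
Proof.
move=> a b c; rewrite -(pi1_reprK a) -(pi1_reprK b) -(pi1_reprK c) !pi1_mulE.
by apply/pi1_classP/loop_concatA.
Qed.

Let pi1_mul1 : right_id pi1_one pi1_mul.
Proof. by move=> a; rewrite -(pi1_reprK a) pi1_mulE; apply/pi1_classP/loop_concat1. Qed.

Let pi1_1mul : left_id pi1_one pi1_mul.
Proof. by move=> a; rewrite -(pi1_reprK a) pi1_mulE; apply/pi1_classP/loop_1concat. Qed.

Let pi1_mulV : right_inverse pi1_one pi1_inv pi1_mul.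
Proof.
move=> a; rewrite -(pi1_reprK a) pi1_invE pi1_mulE.
by apply/pi1_classP/loop_concatV.
Qed.

Let pi1_Vmul : left_inverse pi1_one pi1_inv pi1_mul.
Proof.
move=> a; rewrite -(pi1_reprK a) pi1_invE -{2}(loop_invK (repr a)) pi1_mulE.
by apply/pi1_classP/loop_concatV.
Qed.

HB.instance Definition _ := isGroup.Build (pi1 R x0)
  pi1_mulA pi1_1mul pi1_mul1 pi1_Vmul pi1_mulV.

End FundamentalGroupLaw.

Section Wreath.
Variables (n : nat) (G : groupType).
Local Open Scope group_scope.

(* The pair (f, s) stands for the element f s of G^n ><| 'S_n. *)
Record wreath := Wreath { wbase : {ffun 'I_n -> G}; wperm : 'S_n }.

Definition wreath_pair h := (wbase h, wperm h).
Definition pair_wreath (p : {ffun 'I_n -> G} * 'S_n) := Wreath p.1 p.2.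
Lemma wreath_pairK : cancel wreath_pair pair_wreath. Proof. by case. Qed.

HB.instance Definition _ := Choice.copy wreath (can_type wreath_pairK).

Definition wreath_one := Wreath [ffun=> 1] 1.

Definition wreath_inv h :=
  Wreath [ffun k => (wbase h (wperm h k))^-1] (wperm h)^-1.

(* The product of permutations in MathComp is the opposite of composition:
   (s * t) k = t (s k). *)
Definition wreath_mul h h' :=
  Wreath [ffun k => wbase h k * wbase h' ((wperm h)^-1 k)]
         (wperm h' * wperm h).

Let wreath_mulA : associative wreath_mul.
Proof.
move=> h1 h2 h3; congr Wreath => /=; last by rewrite mulgA.
by apply/ffunP => k; rewrite !ffunE invMg permM mulgA.
Qed.

Let wreath_mul1 : right_id wreath_one wreath_mul.
Proof.
case=> f s; congr Wreath => /=; last by rewrite mul1g.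
by apply/ffunP => k; rewrite !ffunE mulg1.
Qed.

Let wreath_1mul : left_id wreath_one wreath_mul.
Proof.
case=> f s; congr Wreath => /=; last by rewrite mulg1.
by apply/ffunP => k; rewrite !ffunE mul1g invg1 perm1.
Qed.

Let wreath_mulV : right_inverse wreath_one wreath_inv wreath_mul.
Proof.
case=> f s; congr Wreath => /=; last by rewrite mulVg.
by apply/ffunP => k; rewrite !ffunE permKV mulgV.
Qed.

Let wreath_Vmul : left_inverse wreath_one wreath_inv wreath_mul.
Proof.
case=> f s; congr Wreath => /=; last by rewrite mulgV.
by apply/ffunP => k; rewrite !ffunE invgK mulVg.
Qed.

HB.instance Definition _ := isGroup.Build wreath
  wreath_mulA wreath_1mul wreath_mul1 wreath_Vmul wreath_mulV.

End Wreath.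

Inductive zspan (X : zmodType) (S : set X) : set X :=
| Zspan_gen x : S x -> zspan S x
| Zspan_0 : zspan S 0
| Zspan_sub x y : zspan S x -> zspan S y -> zspan S (x - y).

Inductive rterm (X : Type) : Type :=
| RGen of X
| RZero
| ROne
| ROpp of rterm X
| RAdd of rterm X & rterm X
| RMul of rterm X & rterm X.
Arguments RZero {X}.
Arguments ROne {X}.

Section Presentation.
Variables (X : Type) (rel : rterm X -> rterm X -> Prop).
Local Notation term := (rterm X).

Inductive ring_congr : term -> term -> Prop :=
| Rc_rel a b : rel a b -> ring_congr a b
| Rc_refl a : ring_congr a a
| Rc_sym a b : ring_congr a b -> ring_congr b a
| Rc_trans a b c : ring_congr a b -> ring_congr b c -> ring_congr a c
| Rc_opp a a' : ring_congr a a' -> ring_congr (ROpp a) (ROpp a')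
| Rc_add a a' b b' :
    ring_congr a a' -> ring_congr b b' -> ring_congr (RAdd a b) (RAdd a' b')
| Rc_mul a a' b b' :
    ring_congr a a' -> ring_congr b b' -> ring_congr (RMul a b) (RMul a' b')
| Rc_addA a b c : ring_congr (RAdd a (RAdd b c)) (RAdd (RAdd a b) c)
| Rc_addC a b : ring_congr (RAdd a b) (RAdd b a)
| Rc_0add a : ring_congr (RAdd RZero a) a
| Rc_Nadd a : ring_congr (RAdd (ROpp a) a) RZero
| Rc_mulA a b c : ring_congr (RMul a (RMul b c)) (RMul (RMul a b) c)
| Rc_1mul a : ring_congr (RMul ROne a) a
| Rc_mul1 a : ring_congr (RMul a ROne) a
| Rc_mulDl a b c :
    ring_congr (RMul (RAdd a b) c) (RAdd (RMul a c) (RMul b c))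
| Rc_mulDr a b c :
    ring_congr (RMul a (RAdd b c)) (RAdd (RMul a b) (RMul a c)).

HB.instance Definition _ := gen_eqMixin term.
HB.instance Definition _ := gen_choiceMixin term.

Definition ring_congrb : ssrbool.rel term := [rel a b | `[< ring_congr a b >]].

Lemma ring_congrb_equiv : equiv_class_of ring_congrb.
Proof.
split=> [a|a b|b a c] /=.
- by apply/asboolP; exact: Rc_refl.
- by apply/asboolP/asboolP; exact: Rc_sym.
- by move=> /asboolP ? /asboolP ?; apply/asboolP; exact: (@Rc_trans _ b).
Qed.

Canonical ring_congr_equiv := EquivRelPack ring_congrb_equiv.

(* The ring with generators X and relations rel. *)
Definition presented : Type := {eq_quot ring_congr_equiv}.

HB.instance Definition _ := Choice.on presented.

Definition pclass (a : term) : presented := \pi a.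

Lemma pclassP a b : ring_congr a b <-> pclass a = pclass b.
Proof. by split=> [ab|/eqquotP /asboolP//]; apply/eqquotP/asboolP. Qed.

Lemma prepr (x : presented) : exists a, x = pclass a.
Proof. by exists (repr x); rewrite /pclass reprK. Qed.

Lemma congr_repr a : ring_congr (repr (pclass a)) a.
Proof. by apply/pclassP; rewrite /pclass reprK. Qed.

Definition pzero := pclass RZero.
Definition pone := pclass ROne.
Definition popp (x : presented) := pclass (ROpp (repr x)).
Definition padd (x y : presented) := pclass (RAdd (repr x) (repr y)).
Definition pmul (x y : presented) := pclass (RMul (repr x) (repr y)).

Lemma poppE a : popp (pclass a) = pclass (ROpp a).
Proof. by apply/pclassP/Rc_opp/congr_repr. Qed.
Lemma paddE a b : padd (pclass a) (pclass b) = pclass (RAdd a b).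
Proof. by apply/pclassP/Rc_add; exact: congr_repr. Qed.
Lemma pmulE a b : pmul (pclass a) (pclass b) = pclass (RMul a b).
Proof. by apply/pclassP/Rc_mul; exact: congr_repr. Qed.

Let paddA : associative padd.
Proof.
move=> x y z; have [[a ->] [b ->] [c ->]] := And3 (prepr x) (prepr y) (prepr z).
by rewrite !paddE; apply/pclassP/Rc_addA.
Qed.
Let paddC : commutative padd.
Proof.
move=> x y; have [[a ->] [b ->]] := conj (prepr x) (prepr y).
by rewrite !paddE; apply/pclassP/Rc_addC.
Qed.
Let padd0 : left_id pzero padd.
Proof. by move=> x; have [a ->] := prepr x; rewrite paddE; apply/pclassP/Rc_0add. Qed.
Let paddN : left_inverse pzero popp padd.
Proof.
move=> x; have [a ->] := prepr x.
by rewrite poppE paddE; apply/pclassP/Rc_Nadd.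
Qed.

HB.instance Definition _ := GRing.isZmodule.Build presented paddA paddC padd0 paddN.

Let pmulA : associative pmul.
Proof.
move=> x y z; have [[a ->] [b ->] [c ->]] := And3 (prepr x) (prepr y) (prepr z).
by rewrite !pmulE; apply/pclassP/Rc_mulA.
Qed.
Let pmul1 : left_id pone pmul.
Proof. by move=> x; have [a ->] := prepr x; rewrite pmulE; apply/pclassP/Rc_1mul. Qed.
Let pmulr1 : right_id pone pmul.
Proof. by move=> x; have [a ->] := prepr x; rewrite pmulE; apply/pclassP/Rc_mul1. Qed.
Let pmulDl : left_distributive pmul padd.
Proof.
move=> x y z; have [[a ->] [b ->] [c ->]] := And3 (prepr x) (prepr y) (prepr z).
by rewrite !(pmulE, paddE); apply/pclassP/Rc_mulDl.
Qed.
Let pmulDr : right_distributive pmul padd.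
Proof.
move=> x y z; have [[a ->] [b ->] [c ->]] := And3 (prepr x) (prepr y) (prepr z).
by rewrite !(pmulE, paddE); apply/pclassP/Rc_mulDr.
Qed.

HB.instance Definition _ :=
  GRing.Zmodule_isPzRing.Build presented pmulA pmul1 pmulr1 pmulDl pmulDr.

End Presentation.

Fixpoint rterm_map (X Y : Type) (f : X -> Y) (a : rterm X) : rterm Y :=
  match a with
  | RGen x => RGen (f x)
  | RZero => RZero
  | ROne => ROne
  | ROpp a => ROpp (rterm_map f a)
  | RAdd a b => RAdd (rterm_map f a) (rterm_map f b)
  | RMul a b => RMul (rterm_map f a) (rterm_map f b)
  end.

Section ChordAlgebra.
Variables (n : nat) (G : groupType).

Record tgen :=
  TGen { tfst : 'I_n; tsnd : 'I_n; tneq : tfst != tsnd; tlabel : G }.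

Local Notation t := (fun i j ij g => RGen (@TGen i j ij g)).

Inductive trel : rterm tgen -> rterm tgen -> Prop :=
| Trel_sym i j (ij : i != j) (ji : j != i) (g : G) :
    trel (t i j ij g) (t j i ji g^-1%g)
| Trel_comm i j k l (ij : i != j) (kl : k != l) (g d : G) :
    uniq [:: i; j; k; l] ->
    trel (RMul (t i j ij g) (t k l kl d)) (RMul (t k l kl d) (t i j ij g))
| Trel_4T i j k (ij : i != j) (jk : j != k) (ik : i != k) (g d : G) :
    trel (RMul (t i j ij g) (RAdd (t j k jk d) (t i k ik (g * d)%g)))
         (RMul (RAdd (t j k jk d) (t i k ik (g * d)%g)) (t i j ij g)).

Definition chord_alg := presented trel.
HB.instance Definition _ := GRing.PzRing.on chord_alg.

Definition chord (x : tgen) : chord_alg := pclass trel (RGen x).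

Definition chord_homog (d : nat) : set chord_alg :=
  zspan [set a | exists s : d.-tuple tgen, a = \prod_(x <- s) chord x].

Lemma chord_homog0 d : chord_homog d 0. Proof. exact: Zspan_0. Qed.
Lemma chord_homogB d a b :
  chord_homog d a -> chord_homog d b -> chord_homog d (a - b).
Proof. exact: Zspan_sub. Qed.
Lemma chord_homogN d a : chord_homog d a -> chord_homog d (- a).
Proof. by rewrite -sub0r; apply: chord_homogB; exact: chord_homog0. Qed.
Lemma chord_homogD d a b :
  chord_homog d a -> chord_homog d b -> chord_homog d (a + b).
Proof. by move=> ha hb; rewrite -[b]opprK; apply/chord_homogB/chord_homogN. Qed.

(* An element of the completion is a formal series: its component of degree d
   is homogeneous of degree d, for every d. *)
Record chord_series := ChordSeries {
  scoef :> nat -> chord_alg;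
  scoefP : forall d, chord_homog d (scoef d) }.

HB.instance Definition _ := gen_eqMixin chord_series.
HB.instance Definition _ := gen_choiceMixin chord_series.

Lemma chord_seriesP (a b : chord_series) : a =1 b -> a = b.
Proof.
case: a b => [a pa] [b pb] /= /funext ab; subst b.
by congr ChordSeries; exact: Prop_irrelevance.
Qed.

Definition series0 := ChordSeries chord_homog0.
Definition seriesN (a : chord_series) :=
  ChordSeries (fun d => chord_homogN (scoefP a d)).
Definition seriesD (a b : chord_series) :=
  ChordSeries (fun d => chord_homogD (scoefP a d) (scoefP b d)).

Let seriesDA : associative seriesD.
Proof. by move=> a b c; apply: chord_seriesP => d /=; rewrite addrA. Qed.
Let seriesDC : commutative seriesD.
Proof. by move=> a b; apply: chord_seriesP => d /=; rewrite addrC. Qed.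
Let series0D : left_id series0 seriesD.
Proof. by move=> a; apply: chord_seriesP => d /=; rewrite add0r. Qed.
Let seriesND : left_inverse series0 seriesN seriesD.
Proof. by move=> a; apply: chord_seriesP => d /=; rewrite addNr. Qed.

HB.instance Definition _ :=
  GRing.isZmodule.Build chord_series seriesDA seriesDC series0D seriesND.

Local Notation H := (wreath n G).

(* For h = f s, where f lies in G^n and s in 'S_n, the given formulas amount to
   h t_(i, j, g) h^-1 = t_(s i, s j, f (s i) * g * f (s j)^-1): the factor on
   the right comes from t_(i, j, g) = t_(j, i, g^-1). *)
Lemma tgen_act_neq (h : H) (x : tgen) : wperm h (tfst x) != wperm h (tsnd x).
Proof. by rewrite (inj_eq perm_inj) tneq. Qed.

Definition tgen_act (h : H) (x : tgen) : tgen :=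
  TGen (tgen_act_neq h x)
    (wbase h (wperm h (tfst x)) * tlabel x *
     (wbase h (wperm h (tsnd x)))^-1)%g.

Definition chord_act (h : H) (a : chord_alg) : chord_alg :=
  pclass trel (rterm_map (tgen_act h) (repr a)).

Lemma trel_act (h : H) a b : trel a b ->
  trel (rterm_map (tgen_act h) a) (rterm_map (tgen_act h) b).
Proof.
case=> [i j ij ji g|i j k l ij kl g d u|i j k ij jk ik g d] /=.
- rewrite /tgen_act /=.
  rewrite (_ : (_ * g^-1 * _)%g = (wbase h (wperm h i) * g * (wbase h (wperm h j))^-1)^-1%g).
    exact: Trel_sym.
  by rewrite !invgM invgK mulgA.
- apply: Trel_comm; rewrite -[X in uniq X]/(map (wperm h) [:: i; j; k; l]).
  by rewrite map_inj_uniq//; exact: perm_inj.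
- rewrite /tgen_act /=.
  rewrite (_ : (_ * (g * d) * _)%g =
    (wbase h (wperm h i) * g * (wbase h (wperm h j))^-1 *
     (wbase h (wperm h j) * d * (wbase h (wperm h k))^-1))%g).
    exact: Trel_4T.
  by rewrite !mulgA mulgVK.
Qed.

Lemma ring_congr_act (h : H) a b : ring_congr trel a b ->
  ring_congr trel (rterm_map (tgen_act h) a) (rterm_map (tgen_act h) b).
Proof.
elim=> /=; try by move=> *; constructor.
- by move=> x y xy; apply: Rc_rel; exact: trel_act.
- by move=> x y z _ + _; exact: Rc_trans.
Qed.

Lemma chord_act_class (h : H) a :
  chord_act h (pclass trel a) = pclass trel (rterm_map (tgen_act h) a).
Proof. by apply/pclassP/ring_congr_act/congr_repr. Qed.

Lemma chord_act_gen (h : H) x : chord_act h (chord x) = chord (tgen_act h x).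
Proof. exact: chord_act_class. Qed.

Lemma chord_act_is_zmod_morphism (h : H) : zmod_morphism (chord_act h).
Proof.
move=> x y; have [[a ->] [b ->]] := conj (prepr x) (prepr y).
have addE u v : pclass trel u + pclass trel v = pclass trel (RAdd u v).
  exact: paddE.
have oppE u : - pclass trel u = pclass trel (ROpp u) by exact: poppE.
by rewrite oppE addE !chord_act_class oppE addE.
Qed.

Lemma chord_act_is_monoid_morphism (h : H) : monoid_morphism (chord_act h).
Proof.
split=> [|x y]; first exact: chord_act_class.
have [[a ->] [b ->]] := conj (prepr x) (prepr y).
have mulE u v : pclass trel u * pclass trel v = pclass trel (RMul u v).
  exact: pmulE.
by rewrite mulE !chord_act_class mulE.
Qed.

(* Finitely supported functions on H with values in A stand for the tensor
   product of A and Z[H]. *)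
Definition chord_crossed := malg H chord_alg.
Definition series_crossed := malg H chord_series.
HB.instance Definition _ := GRing.Zmodule.on chord_crossed.
HB.instance Definition _ := GRing.Zmodule.on series_crossed.

Definition crossed_one : chord_crossed := mkmalgU 1%g 1.

Definition crossed_mul (x y : chord_crossed) : chord_crossed :=
  \sum_(h <- msupp x) \sum_(h' <- msupp y)
    mkmalgU (h * h')%g (mcoeff h x * chord_act h (mcoeff h' y)).

Definition crossed_homog (d : nat) : set chord_crossed :=
  [set x | forall h, chord_homog d (mcoeff h x)].

Definition series_filtration (d : nat) : set series_crossed :=
  [set y | forall h k, (k < d)%N -> scoef (mcoeff h y) k = 0].

(* On the d-th step of the filtration, the component of degree d induces the
   isomorphism from the degree d part of the associated graded module onto
   crossed_homog d. *)
Definition series_component (d : nat) (y : series_crossed) : chord_crossed :=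
  \sum_(h <- msupp y) mkmalgU h (scoef (mcoeff h y) d).

Lemma series_componentE d (y : series_crossed) h :
  mcoeff h (series_component d y) = scoef (mcoeff h y) d.
Proof.
rewrite /series_component raddf_sum /=.
under eq_bigr do rewrite mcoeffU.
have [hy|hy] := boolP (h \in msupp y).
  rewrite (big_fsetD1 h)//= eqxx big1_fset ?addr0// => i.
  by rewrite !inE => /andP[/negbTE /= -> _] _; rewrite ?mulr0n.
rewrite big1_fset; first by rewrite (mcoeff_outdom hy).
move=> i iy _; case: eqP => [ih|]; rewrite ?mulr0n//.
by move: hy; rewrite -ih iy.
Qed.

End ChordAlgebra.

Section Smooth.
Context {R : realType}.

(* f is of class C^k on the open set U. *)
Fixpoint class_C (V W : normedModType R) (k : nat) (f : V -> W) (U : set V) :=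
  (forall x, U x -> {for x, continuous f}) /\
  (if k is k'.+1 then
     forall v, (forall x, U x -> derivable f x v) /\ class_C k' ('D_v f) U
   else True).

Definition smooth (V W : normedModType R) (f : V -> W) (U : set V) :=
  forall k, class_C k f U.

Lemma smooth_cst (V W : normedModType R) (w : W) (U : set V) :
  smooth (fun=> w) U.
Proof.
move=> k; elim: k w => [|k IH] w /=; split=> //; try by move=> x _; exact: cvg_cst.
move=> v; split=> [x _|]; first exact: derivable_cst.
by rewrite (_ : 'D_v _ = fun=> 0)//; apply/funext => x; exact: derive_cst.
Qed.

Record chart (M : topologicalType) := Chart {
  cdom : set M;
  cmap :> M -> 'rV[R]_2;
  cdom_open : open cdom;
  cmap_inj : {in cdom &, injective cmap};
  cmap_continuous : forall x, cdom x -> {for x, continuous cmap};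
  cmap_open : forall O, open O -> O `<=` cdom -> open (cmap @` O) }.

Definition oriented_transition (M : topologicalType) (c c' : chart M) :=
  exists2 g : 'rV[R]_2 -> 'rV[R]_2,
    smooth g (c @` (cdom c `&` cdom c')) &
    forall x, cdom c x -> cdom c' x ->
      g (c x) = c' x /\ 0 < \det (jacobian g (c x)).
End Smooth.

(* Closed connected smooth surfaces with an orientation; compactness makes them
   second countable. *)
Record oriented_surface (R : realType) := OrientedSurface {
  surf :> topologicalType;
  surf_hausdorff : hausdorff_space surf;
  surf_compact : compact [set: surf];
  surf_connected : connected [set: surf];
  atlas : set (@chart R surf);
  atlas_cover : forall x : surf, exists2 c, atlas c & cdom c x;
  atlas_oriented : forall c c', atlas c -> atlas c' -> oriented_transition c c' }.

Section Genus.
Context {R : realType}.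

Definition simple_closed_curve (M : topologicalType) (c : R -> M) :=
  [/\ {within `[0, 1], continuous c}, c 0 = c 1 &
      {in `[0, 1[ &, injective c}].

Definition nonseparating_curves (M : topologicalType) (k : nat) :=
  exists c : 'I_k -> R -> M,
    [/\ forall i, simple_closed_curve (c i),
        forall i j, i != j -> (c i @` `[0, 1]) `&` (c j @` `[0, 1]) = set0 &
        connected (~` \bigcup_(i in [set: 'I_k]) (c i @` `[0, 1]))].
End Genus.

(* The genus is the largest number of disjoint simple closed curves whose union
   does not disconnect the surface. *)
Definition has_genus (R : realType) (M : oriented_surface R) (g : nat) :=
  @nonseparating_curves R M g /\
  forall k, @nonseparating_curves R M k -> (k <= g)%N.

Section Braids.
Context {R : realType} {M : oriented_surface R} {n : nat}.
Implicit Type P : 'I_n -> M.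

(* Smoothness of a map on an arbitrary subset: near each point, the map is the
   restriction of a smooth map defined on an open set. *)
Definition smooth_into (V : normedModType R) (f : V -> M) (A : set V) :=
  forall p, A p -> exists c : chart M, exists U : set V, exists g : V -> 'rV[R]_2,
    [/\ atlas c, open U, U p, smooth g U &
        forall q, U q -> A q -> cdom c (f q) /\ c (f q) = g q].

(* The strings, parametrized by their height t: the i-th string is
   t |-> (b i t, t), for 0 <= t <= 1. *)
Local Notation strings := ('I_n -> R -> M).

Definition singular_points (b : strings) : set ('I_n * 'I_n * R) :=
  [set p : 'I_n * 'I_n * R | [/\ (p.1.1 < p.1.2)%N, 0 <= p.2 <= 1 & b p.1.1 p.2 = b p.1.2 p.2]].

Record is_singular_braid P (d : nat) (b : strings) : Prop := IsSingularBraid {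
  sb_smooth : forall i, smooth_into (b i) `[0, 1];
  sb_start : forall i, b i 0 = P i;
  sb_end : exists s : 'S_n, forall i, b i 1 = P (s i);
  sb_double : forall i j k t, 0 <= t <= 1 -> b i t = b j t -> b j t = b k t ->
    ~~ uniq [:: i; j; k];
  sb_transverse : forall i j t (c : chart M), i != j -> 0 <= t <= 1 ->
    b i t = b j t -> atlas c -> cdom c (b i t) ->
    derive1 (fun x => c (b i x)) t != derive1 (fun x => c (b j x)) t;
  sb_card : (singular_points b #= `I_d)%card }.

Record singular_braid P (d : nat) := SingularBraid {
  sb_strings :> strings;
  sb_strings_subproof : is_singular_braid P d sb_strings }.

HB.instance Definition _ P d := gen_eqMixin (singular_braid P d).
HB.instance Definition _ P d := gen_choiceMixin (singular_braid P d).

(* The two-parameter family F, with F i (s, t) in M, is a smooth deformation. *)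
Local Notation family := ('I_n -> R * R -> M).

Definition isotopic P d (b b' : singular_braid P d) := exists F : family,
  [/\ forall i, smooth_into (F i) (`[0, 1] `*` `[0, 1]),
      forall s, 0 <= s <= 1 -> is_singular_braid P d (fun i t => F i (s, t)),
      forall i t, 0 <= t <= 1 -> F i (0, t) = b i t &
      forall i t, 0 <= t <= 1 -> F i (1, t) = b' i t].

Definition isotopicb P d : rel (singular_braid P d) :=
  [rel b b' | `[< clos_refl_sym_trans _ (@isotopic P d) b b' >]].

Lemma isotopicb_equiv P d : equiv_class_of (@isotopicb P d).
Proof.
split=> [b|b b'|b' b b''] /=.
- by apply/asboolP; exact: rst_refl.
- by apply/asboolP/asboolP; exact: rst_sym.
- by move=> /asboolP ? /asboolP ?; apply/asboolP; exact: (@rst_trans _ _ _ b').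
Qed.

Canonical isotopicb_equivRel P d := EquivRelPack (@isotopicb_equiv P d).

(* S_d B_n(M), with P as base points *)
Definition SB P d : Type := {eq_quot (@isotopicb_equivRel P d)}.
HB.instance Definition _ P d := Choice.on (SB P d).

(* The braid group B_n(M) *)
Definition BM P : Type := SB P 0.
HB.instance Definition _ P := Choice.on (BM P).

Definition sb_class P d (b : singular_braid P d) : SB P d := \pi b.

(* F crosses the braid F (0, -) with d.+1 singular points, those of F (s, -)
   being d in number for s <> 0. At the singular point (i, j, t0) that is
   resolved, w = c (F j) - c (F i) has nonzero derivatives w_s and w_t. When
   det (w_s, w_t) > 0, the strings i and j turn counterclockwise around each
   other near t0 for s > 0, and clockwise for s < 0: the crossing is positive
   for s > 0, negative for s < 0. The sign does not change if i and j are
   exchanged. *)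
Definition is_resolution P d (b : singular_braid P d.+1)
    (bp bm : singular_braid P d) := exists F : family,
  [/\ forall i, smooth_into (F i) (`[-1, 1] `*` `[0, 1]),
      forall s, -1 <= s <= 1 -> s != 0 ->
        is_singular_braid P d (fun i t => F i (s, t)),
      forall i t, 0 <= t <= 1 ->
        [/\ F i (0, t) = b i t, F i (1, t) = bp i t & F i (-1, t) = bm i t] &
      exists i, exists j, exists t0 : R,
        [/\ i != j, 0 < t0 < 1, b i t0 = b j t0 &
            forall c : chart M, atlas c -> cdom c (b i t0) ->
              let w := fun p : R * R => c (F j p) - c (F i p) in
              0 < \det (col_mx ('D_((1, 0) : R * R) w (0, t0) : 'rV[R]_2)
                               ('D_((0, 1) : R * R) w (0, t0) : 'rV[R]_2))]].

Definition resolution P d (b : SB P d.+1) (bp bm : SB P d) :=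
  exists b0 : singular_braid P d.+1, exists bp0 bm0 : singular_braid P d,
    [/\ b = sb_class b0, bp = sb_class bp0, bm = sb_class bm0 &
        is_resolution b0 bp0 bm0].

(* Z[B_n(M)] *)
Definition ZB P := malg (BM P) int.
HB.instance Definition _ P := GRing.Zmodule.on (ZB P).

Definition ZB_braid P (b : BM P) : ZB P := mkmalgU b 1.

(* The graph of eta: the value does not depend on the order in which the
   singular points are resolved. *)
Inductive eta P : forall d, SB P d -> ZB P -> Prop :=
| Eta_braid (b : BM P) : @eta P 0 b (ZB_braid b)
| Eta_resolution d (b : SB P d.+1) bp bm xp xm :
    resolution b bp bm -> eta bp xp -> eta bm xm -> eta b (xp - xm).

Definition vassiliev_filtration P (d : nat) : set (ZB P) :=
  zspan [set x | exists b : SB P d, eta b x].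

(* Smoothness is not preserved by concatenation, so a product of classes is
   the class of a smooth concatenation of representatives. *)
Definition is_concat P (b b' b'' : singular_braid P 0) :=
  forall i j t, b i 1 = P j -> 0 <= t <= 1 ->
    b'' i (t / 2) = b i t /\ b'' i ((1 + t) / 2) = b' j t.

Definition BM_product P (a a' : BM P) : set (BM P) :=
  [set a'' | exists b b' b'' : singular_braid P 0,
    [/\ a = sb_class b, a' = sb_class b', a'' = sb_class b'' &
        is_concat b b' b'']].

(* Every pair of classes has exactly one product; the default value a of xget
   plays no role. *)
Definition BM_mul P (a a' : BM P) : BM P := xget a (BM_product a a').

Definition ZB_mul P (x y : ZB P) : ZB P :=
  \sum_(a <- msupp x) \sum_(a' <- msupp y)
    mkmalgU (BM_mul a a') (mcoeff a x * mcoeff a' y).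

Lemma trivial_braid_subproof P : injective P ->
  is_singular_braid P 0 (fun i _ => P i).
Proof.
move=> injP; split.
- move=> i t _; have [c ac cx] := atlas_cover (P i).
  exists c, setT, (fun=> c (P i)); split=> //; first exact: openT.
  exact: smooth_cst.
- by [].
- by exists 1%g => i; rewrite perm1.
- by move=> i j k t _ /injP -> _; rewrite /= inE eqxx.
- by move=> i j t c ij _ /injP e; rewrite e eqxx in ij.
- rewrite (_ : singular_points _ = set0) ?II0//.
  apply/seteqP; split=> // -[[i j] t] [/= ij _ /injP e].
  by rewrite e ltnn in ij.
Qed.

Definition trivial_braid P (injP : injective P) :=
  SingularBraid (trivial_braid_subproof injP).

Definition BM_one P (injP : injective P) : BM P := sb_class (trivial_braid injP).

End Braids.

Section Invariants.
Context {R : realType} {M : oriented_surface R} {n : nat} {P : 'I_n -> M}.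

(* The linear extension to Z[B_n(M)] of a map on B_n(M) *)
Definition linear_ext (A : zmodType) (v : BM P -> A) (x : ZB P) : A :=
  \sum_(b <- msupp x) v b *~ mcoeff b x.

Definition vassiliev_of_type (A : zmodType) (d : nat) (v : BM P -> A) :=
  forall x : ZB P, vassiliev_filtration d.+1 x -> linear_ext v x = 0.

Context {x0 : M}.
Local Notation G := (pi1 R x0).

Definition filtration_preserving (u : ZB P -> series_crossed n G) :=
  forall d x, vassiliev_filtration d x -> series_filtration d (u x).

(* For x in V_d, the image under gr u of the class of x in V_d / V_(d.+1). *)
Definition gr (u : ZB P -> series_crossed n G) (d : nat) (x : ZB P) :
    chord_crossed n G :=
  series_component d (u x).

(* For a filtration preserving u, gr u is an isomorphism of graded rings. *)
Record gr_isomorphism (injP : injective P)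
    (u : ZB P -> series_crossed n G) : Prop := GrIsomorphism {
  gr_injective : forall d x, vassiliev_filtration d x ->
    gr u d x = 0 -> vassiliev_filtration d.+1 x;
  gr_surjective : forall d y, crossed_homog d y ->
    exists2 x, vassiliev_filtration d x & gr u d x = y;
  gr_mul : forall d e x y,
    vassiliev_filtration d x -> vassiliev_filtration e y ->
    gr u (d + e) (ZB_mul x y) = crossed_mul (gr u d x) (gr u e y);
  gr_one : gr u 0 (ZB_braid (BM_one injP)) = crossed_one n G }.

(* Continuity for the topology defined by the filtration and the discrete
   topology on A. The image of u is only dense, so that factorizations through u
   are unique among these maps, but not among all additive maps. *)
Definition filtration_continuous (A : zmodType)
    (w : series_crossed n G -> A) :=
  exists N, forall y, series_filtration N y -> w y = 0.

End Invariants.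

(* Main.v *)
From HB Require Import structures.
From mathcomp Require Import finmap.
From mathcomp.multinomials Require Import -(notations) monalg.
Require Import Defs.
From mathcomp Require Import all_boot all_order all_algebra.
From mathcomp Require Import all_classical reals topology.

(** Write V_d for the Vassiliev filtration and F_d for the filtration of the
    crossed product by degree. Since gr u is bijective in each degree, u
    induces an isomorphism of Z[B_n(M)] / V_N onto the crossed product modulo
    F_N, for every N:
    - surjectivity of gr u lets one correct an approximate preimage of y degree
      by degree, so that y agrees with some u x up to F_N
      ([gr_isomorphism_dense]);
    - injectivity of gr u, used degree by degree starting from V_0, which is
      everything, shows that u x in F_N forces x in V_N
      ([gr_isomorphism_strict]).
    An invariant of type d is a map on Z[B_n(M)] / V_(d+1), so it is transported
    along this isomorphism for N = d + 1 ([additive_factor]).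

    Two continuous maps with the same composite with u agree on the image of u
    and vanish on a common F_N; as the image of u meets every class modulo
    F_N, they are equal. *)

Set Implicit Arguments.
Unset Strict Implicit.
Unset Printing Implicit Defensive.

Import GRing.Theory.
Local Open Scope ring_scope.

(** The second hypothesis says that u is onto modulo F, the third that f kills
    the kernel of u modulo F. So w y can be defined as f x for any choice of x
    with u x = y modulo F; independence of the choice gives additivity. *)
Lemma additive_factor (X Y A : zmodType) (u : {additive X -> Y})
    (f : {additive X -> A}) (F : set Y) :
  (forall y z, F y -> F z -> F (y - z)) ->
  (forall y, exists x, F (y - u x)) ->
  (forall x, F (u x) -> f x = 0) ->
  exists w : {additive Y -> A},
    (forall y, F y -> w y = 0) /\ (forall x, w (u x) = f x).
Proof.
move=> FB /choice[s sP] fF.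
have F0 : F 0 by rewrite -(subrr (0 - u (s 0))); apply: FB.
have wE y x : F (y - u x) -> f (s y) = f x.
  move=> yx; apply/eqP; rewrite -subr_eq0 -raddfB fF// raddfB.
  rewrite (_ : u (s y) - u x = (y - u x) - (y - u (s y))); first exact: FB.
  by rewrite opprB [RHS]addrC addrA subrK.
have wB : zmod_morphism (f \o s).
  move=> y z /=; rewrite -raddfB; apply: wE.
  by rewrite raddfB opprD addrACA -opprD; apply: FB.
pose w : {additive Y -> A} :=
  HB.pack (f \o s) (GRing.isZmodMorphism.Build _ _ _ wB).
exists w; split=> [y Fy|x] /=.
  by rewrite (wE y 0) !raddf0 ?addr0.
by apply: wE; rewrite subrr.
Qed.

Lemma zspanD (X : zmodType) (S : set X) (x y : X) :
  zspan S x -> zspan S y -> zspan S (x + y).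
Proof.
move=> Sx Sy; rewrite -[y]opprK -[- y]sub0r.
by do ?apply: Zspan_sub => //; exact: Zspan_0.
Qed.

Lemma zspan_mulrz (X : zmodType) (S : set X) (x : X) (m : int) :
  zspan S x -> zspan S (x *~ m).
Proof.
move=> Sx; have nat_mul k : zspan S (x *+ k).
  by elim: k => [|k IH]; [exact: Zspan_0|rewrite mulrS; exact: zspanD].
case: m => k; first exact: nat_mul.
by rewrite NegzE mulrNz -sub0r; apply: Zspan_sub; [exact: Zspan_0|exact: nat_mul].
Qed.

Section Braids.
Context {R : realType} {M : oriented_surface R} {n : nat} {P : 'I_n -> M}.

Section LinearExtension.
Context {A : zmodType} (v : BM P -> A).

Lemma linear_extEw (E : {fset BM P}) (x : ZB P) : (msupp x `<=` E)%fset ->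
  linear_ext v x = \sum_(b <- E) v b *~ mcoeff b x.
Proof.
move=> xE; apply: big_fset_incl => // b _ /mcoeff_outdom ->.
by rewrite mulr0z.
Qed.

Lemma linear_ext_is_zmod_morphism : zmod_morphism (linear_ext v).
Proof.
move=> x y; pose E := (msupp x `|` msupp y)%fset.
rewrite (@linear_extEw E) ?msuppB_le// !(@linear_extEw E) ?fsubsetUl ?fsubsetUr//.
by rewrite -sumrB; apply: eq_bigr => b _; rewrite mcoeffB mulrzBr.
Qed.

HB.instance Definition _ :=
  GRing.isZmodMorphism.Build (ZB P) A (linear_ext v) linear_ext_is_zmod_morphism.
End LinearExtension.

(** A braid is a singular braid without singular points and equals its own
    image under eta. *)
Lemma vassiliev_filtration0 (x : ZB P) : vassiliev_filtration 0 x.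
Proof.
rewrite [x]monalgE; elim/big_ind: _ => [||b _]; [exact: Zspan_0|exact: zspanD|].
rewrite -[mcoeff b x]intz raddfMz; apply/zspan_mulrz/Zspan_gen.
by exists b; exact: Eta_braid.
Qed.

Section Series.
Context {G : groupType}.

Lemma scoefB (a b : chord_series n G) k :
  scoef (a - b) k = scoef a k - scoef b k.
Proof. by []. Qed.

Lemma series_filtrationB d (y z : series_crossed n G) :
  series_filtration d y -> series_filtration d z -> series_filtration d (y - z).
Proof.
by move=> yd zd h k kd; rewrite mcoeffB scoefB yd// zd// subrr.
Qed.

Lemma series_filtration_le d e (y : series_crossed n G) :
  (d <= e)%N -> series_filtration e y -> series_filtration d y.
Proof. by move=> de ye h k kd; apply: ye; exact: leq_trans de. Qed.

Lemma series_filtrationS d (y : series_crossed n G) :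
  series_filtration d y -> series_component d y = 0 -> series_filtration d.+1 y.
Proof.
move=> yd y0 h k; rewrite ltnS leq_eqVlt => /predU1P[->|]; last exact: yd.
by rewrite -series_componentE y0 mcoeff0.
Qed.

Lemma series_componentB d (y z : series_crossed n G) :
  series_component d (y - z) = series_component d y - series_component d z.
Proof.
apply/malgP => h; rewrite [LHS]series_componentE [RHS]mcoeffB.
by rewrite [X in scoef X]mcoeffB scoefB -!series_componentE.
Qed.

Lemma series_component_homog d (y : series_crossed n G) :
  crossed_homog d (series_component d y).
Proof. by move=> h; rewrite series_componentE; exact: scoefP. Qed.
End Series.

Section Graded.
Context {x0 : M} {injP : injective P}.
Context (u : {additive ZB P -> series_crossed n (pi1 R x0)}).
Hypotheses (u_filt : filtration_preserving u) (u_gr : gr_isomorphism injP u).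

(** If y - u x lies in F_N, its component of degree N is gr u of some x' in V_N;
    then u x' has the same leading term as y - u x, and x + x' is an approximate
    preimage of y to the next order. *)
Lemma gr_isomorphism_dense N (y : series_crossed n (pi1 R x0)) :
  exists x, series_filtration N (y - u x).
Proof.
elim: N => [|N [x yx]]; first by exists 0.
have [x' x'N x'y] := gr_surjective u_gr (@series_component_homog _ N (y - u x)).
exists (x + x'); rewrite raddfD opprD addrA; apply: series_filtrationS.
  by apply: series_filtrationB yx _; exact: u_filt.
by rewrite series_componentB -x'y; exact: subrr.
Qed.

(** If x lies in V_N and u x in F_(N+1), then gr u kills the class of x in
    V_N / V_(N+1), so x lies in V_(N+1). *)
Lemma gr_isomorphism_strict N (x : ZB P) :
  series_filtration N (u x) -> vassiliev_filtration N x.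
Proof.
elim: N => [|N IH] ux; first exact: vassiliev_filtration0.
apply: (gr_injective u_gr); first exact/IH/(series_filtration_le (leqnSn N)).
by apply/malgP => h; rewrite /gr series_componentE mcoeff0 ux.
Qed.
End Graded.

End Braids.

Theorem corollary1p4 (R : realType) (M : oriented_surface R) (g : nat)
    (g_ge1 : (1 <= g)%N) (genusM : has_genus M g)
    (n : nat) (P : 'I_n -> M) (injP : injective P) (x0 : M)
    (u : {additive ZB P -> series_crossed n (pi1 R x0)})
    (u_filt : filtration_preserving u) (u_gr : gr_isomorphism injP u)
    (A : zmodType) (d : nat) (v : BM P -> A) (v_type : vassiliev_of_type d v) :
  exists w : {additive series_crossed n (pi1 R x0) -> A},
    [/\ forall y, series_filtration d.+1 y -> w y = 0,
        forall x : ZB P, w (u x) = linear_ext v x &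
        forall w' : {additive series_crossed n (pi1 R x0) -> A},
          filtration_continuous w' ->
          (forall x : ZB P, w' (u x) = linear_ext v x) -> w' =1 w].
Proof.
have [x ux|w [w0 wu]] := additive_factor (f := linear_ext v)
  (@series_filtrationB _ _ d.+1) (gr_isomorphism_dense u_filt u_gr d.+1).
  exact/v_type/(gr_isomorphism_strict u_gr).
exists w; split=> // w' [N w'N] w'u y.
(* N is unrelated to d: y must be approximated finely enough for both maps. *)
have [x yx] := gr_isomorphism_dense u_filt u_gr (maxn N d.+1) y.
have {}w'N : w' (y - u x) = 0.
  exact/w'N/(series_filtration_le (leq_maxl N d.+1)).
have wN : w (y - u x) = 0 by exact/w0/(series_filtration_le (leq_maxr N d.+1)).
by rewrite -[y](subrK (u x)) [LHS]raddfD [RHS]raddfD w'N wN w'u wu.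
Qed.
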